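(* Let $k,l\ge 1$. Let $L_{2k+1}^*$ be the digraph with vertices $u_i,v_i$ ($0\le i\le 2k$) and arcs $(u_i,u_{i+1})$ and $(v_i,v_{i+1})$ for $0\le i\le 2k-1$, and $(v_i,u_i)$ for $0\le i\le 2k$ (the ladder with $2k+1$ rungs oriented left-to-right and bottom-to-top). Then there exists a $((6k+1)l^2+1,\,4k+2,\,l,\,1;\,L_{2k+1}^* )$-EDF in $\mathbb{Z}_{(6k+1)l^2+1}$.
   Context: $\Delta(A,B)=\{a-b:a\in A,b\in B\}$ (multiset). For a group $\Gamma$ of order $N$ and a digraph $H$ with $m$ vertices, a family $(A_v)_{v\in V(H)}$ of pairwise disjoint $l$-subsets of $\Gamma$ is an $(N,m,l,\lambda;H)$-EDF if $\bigcup_{(u,v)\in\overrightarrow{E}(H)}\Delta(A_v,A_u)=\lambda(\Gamma\setminus\{0\})$ as multisets. *)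

(* Defs.v *)
From mathcomp Require Import all_boot all_algebra.

Set Implicit Arguments.
Unset Strict Implicit.
Unset Printing Implicit Defensive.

Import GRing.Theory.
Local Open Scope ring_scope.

(* Multisets are represented by sequences, compared up to [perm_eq]. *)
Definition Delta (G : finZmodType) (A B : {set G}) : seq G :=
  [seq a - b | a <- enum A, b <- enum B].

Definition arcs (V : finType) (H : rel V) : seq (V * V) :=
  enum [pred p : V * V | H p.1 p.2].

(* The difference multiset of an arc (u, v) is head minus tail. *)
Definition arc_differences (G : finZmodType) (V : finType) (H : rel V)
    (A : V -> {set G}) : seq G :=
  flatten [seq Delta (A p.2) (A p.1) | p <- arcs H].

Record is_EDF (G : finZmodType) (N m l lambda : nat) (V : finType)
    (H : rel V) (A : V -> {set G}) : Prop := IsEDF {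
  EDF_order : #|G| = N;
  EDF_vertices : #|V| = m;
  EDF_block_size : forall v : V, #|A v| = l;
  EDF_disjoint : forall u v : V, u != v -> [disjoint A u & A v];
  EDF_differences :
    perm_eq (arc_differences H A)
            (flatten (nseq lambda (enum [set~ (0 : G)])))
}.

(* The oriented ladder with n rungs; [inl i] is u_i and [inr i] is v_i. *)
Definition ladder (n : nat) : rel ('I_n + 'I_n) := fun x y =>
  match x, y with
  | inl i, inl j => nat_of_ord j == i.+1
  | inr i, inr j => nat_of_ord j == i.+1
  | inr i, inl j => i == j
  | inl _, inr _ => false
  end.

(* Main.v *)
(* The ladder carries a bipartite labelling f in [0, q], q = 6k+1, whose low
   labels are at most 3k and whose high labels exceed 3k, such that the directed
   differences f(head) - f(tail) modulo q+1 are 1, ..., q, each once.  Replacing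
   a low label a by { l^2 a + i : i < l } and a high label b by
   { l^2 (b-1) + l(i+1) : i < l } turns a difference d = b - a into the l^2
   consecutive integers of ]l^2(d-1), l^2 d].  Negation modulo N = q l^2 + 1
   maps this interval to the one of q+1-d, so arcs of both directions fit the
   same partition of the nonzero residues. *)
Require Import Defs.
From mathcomp Require Import all_boot all_algebra.
From mathcomp Require Import zify.

Set Implicit Arguments.
Unset Strict Implicit.
Unset Printing Implicit Defensive.

Import GRing.Theory.

Definition block_elt (l c a i : nat) : nat :=
  if a <= c then l ^ 2 * a + i else l ^ 2 * a.-1 + l * i.+1.

Lemma euclid_inj (d q1 q2 r1 r2 : nat) :
  r1 < d -> r2 < d -> d * q1 + r1 = d * q2 + r2 -> q1 = q2 /\ r1 = r2.
Proof.
move=> ltr1 ltr2 eqr; have d_gt0 : 0 < d by exact: leq_ltn_trans ltr1.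
have := congr1 (divn^~ d) eqr.
rewrite ![d * _]mulnC !divnMDl // !divn_small // !addn0 => eqq.
by split=> //; move: eqr; rewrite eqq => /addnI.
Qed.

(** As a <= b - 1, the low element stays below l^2 a + l, which every element of the high block
    reaches. *)
Lemma block_elt_low_lt_high (l c a b i j : nat) :
  i < l -> a <= c < b -> block_elt l c a i < block_elt l c b j.
Proof.
rewrite /block_elt => ltil /andP[leac ltcb]; rewrite leac (leqNgt b) ltcb /=.
have : l ^ 2 * a <= l ^ 2 * b.-1 by rewrite leq_mul2l; lia.
by rewrite mulnS; lia.
Qed.

Lemma block_elt_inj (l c a b i j : nat) : i < l -> j < l ->
  block_elt l c a i = block_elt l c b j -> a = b /\ i = j.
Proof.
move=> ltil ltjl.
have [leac|ltca] := leqP a c; have [lebc|ltcb] := leqP b c.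
- rewrite /block_elt leac lebc.
  by apply: euclid_inj; rewrite -mulnn; nia.
- move=> eqab; have /(block_elt_low_lt_high j ltil) : a <= c < b by rewrite leac.
  by rewrite eqab ltnn.
- move=> eqab; have /(block_elt_low_lt_high i ltjl) : b <= c < a by rewrite lebc.
  by rewrite eqab ltnn.
(* One l is moved out of each [l * i.+1]: the offset l(i+1) can equal l^2, whereas l i is a genuine
   remainder modulo l^2. *)
- rewrite /block_elt !(leqNgt _ c) ltca ltcb /= !mulnS ![l + _]addnC !addnA.
  move=> /addIn /euclid_inj[]; [by rewrite -mulnn; nia..|].
  move=> eqab /eqP; rewrite eqn_mul2l => /orP[|/eqP->]; first by lia.
  by split=> //; lia.
Qed.

(** The largest possible value is q l^2, at the end of the block of the high label q, so reduction
    modulo q l^2 + 1 identifies no two block elements. *)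
Lemma block_elt_bound (l c q a i : nat) :
  i < l -> c < q -> a <= q -> block_elt l c a i < q * l ^ 2 + 1.
Proof.
rewrite addn1 ltnS => ltil ltcq leaq.
have le_block b r : b < q -> r <= l ^ 2 -> l ^ 2 * b + r <= q * l ^ 2.
  move=> ltbq ler; apply: leq_trans (_ : l ^ 2 * b.+1 <= _).
    by rewrite mulnSr leq_add2l.
  by rewrite mulnC leq_mul2r ltbq orbT.
rewrite /block_elt; have [leac|ltca] := leqP a c; apply: le_block.
- exact: leq_ltn_trans ltcq.
- by rewrite -mulnn; nia.
- by rewrite prednK //; apply: leq_ltn_trans ltca.
- by rewrite -mulnn leq_mul2l ltil orbT.
Qed.

(** Dividing r - 1 by l gives r = l(j+1) - i, with j the quotient and l - 1 - i the remainder;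
    l(j+1) is the offset in the high block and i the one in the low block. *)
Lemma block_elt_difference (l c a b r : nat) :
  0 < r <= l ^ 2 -> a <= c < b ->
  exists i j, [/\ i < l, j < l &
    block_elt l c b j = l ^ 2 * (b - a).-1 + r + block_elt l c a i].
Proof.
move=> /andP[r_gt0 ler] /andP[leac ltcb]; rewrite -mulnn in ler.
have l_gt0 : 0 < l by nia.
have := divn_eq r.-1 l; have := ltn_pmod r.-1 l_gt0.
set j := _ %/ l; set s := _ %% l => lts eqr.
have ltj : j < l by nia.
exists (l.-1 - s), j; split=> //; first by lia.
rewrite /block_elt leac (leqNgt b) ltcb /=.
have -> : b.-1 = (b - a).-1 + a by lia.
by rewrite mulnDr; nia.
Qed.

(** Counting leaves no room in [t] for repetitions or foreign elements. For an EDF it thus suffices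
    that every nonzero residue occurs and that there are not too many differences. *)
Lemma perm_of_surj (T : eqType) (s t : seq T) :
  uniq s -> {subset s <= t} -> size t <= size s -> perm_eq t s.
Proof.
move=> s_uniq sub_st le_ts; have [_ eqst] := uniq_min_size s_uniq sub_st le_ts.
have t_uniq := leq_size_uniq s_uniq sub_st le_ts.
by apply: uniq_perm => // x; rewrite eqst.
Qed.

Lemma size_arc_differences (G : finZmodType) (V : finType) (H : rel V)
    (A : V -> {set G}) (l : nat) :
  (forall v, #|A v| = l) -> size (arc_differences H A) = size (arcs H) * l ^ 2.
Proof.
move=> cardA; rewrite /arc_differences size_flatten /shape -map_comp.
rewrite (eq_map (g := fun=> l ^ 2)).
  by elim: (arcs H) => //= _ s /= ->; rewrite mulSn.
by move=> p /=; rewrite size_allpairs -!cardE !cardA mulnn.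
Qed.

Lemma mem_arc_differences (G : finZmodType) (V : finType) (H : rel V)
    (A : V -> {set G}) (x y : V) (a b : G) :
  H x y -> a \in A x -> b \in A y -> (b - a)%R \in arc_differences H A.
Proof.
move=> Hxy aA bA; apply/flattenP; exists (Delta (A y) (A x)).
  by apply/mapP; exists (x, y); rewrite // mem_enum.
by apply/allpairsP; exists (b, a); rewrite !mem_enum.
Qed.

(* The e-th interval of differences is produced by an arc from low to high with
   difference e, or by an arc from high to low with difference q+1-e. *)
Definition realizes (V : Type) (H : rel V) (f : V -> nat) (c q e : nat)
    (x y : V) : Prop :=
  H x y /\ (f x <= c < f y /\ f y - f x = e \/
            f y <= c < f x /\ f x - f y = q.+1 - e).

Lemma EDF_of_labelling (V : finType) (H : rel V) (f : V -> nat)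
    (q c l : nat) :
  0 < l -> c < q -> injective f -> (forall v, f v <= q) ->
  size (arcs H) <= q ->
  (forall e, 0 < e <= q -> exists x y, realizes H f c q e x y) ->
  exists A : V -> {set 'Z_(q * l ^ 2 + 1)},
    is_EDF (q * l ^ 2 + 1) #|V| l 1 H A.
Proof.
move=> l_gt0 ltcq f_inj f_le size_arcs surj.
set N := q * l ^ 2 + 1.
have l2_gt0 : 0 < l ^ 2 by rewrite expn_gt0 l_gt0.
have N_gt1 : 1 < N by rewrite /N; nia.
pose g v i : 'Z_N := ((block_elt l c (f v) i)%:R)%R.
pose A v := [set g v i | i : 'I_l].
have gA v (i : nat) : i < l -> g v i \in A v.
  by move=> lti; apply/imsetP; exists (Ordinal lti).
have g_inj u v (i j : 'I_l) : g u i = g v j -> u = v /\ i = j.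
  move=> /(congr1 (@nat_of_ord _)).
  rewrite /g !val_Zp_nat // !modn_small ?block_elt_bound //.
  by move=> /(block_elt_inj (ltn_ord i) (ltn_ord j)) [/f_inj-> /val_inj->].
have cardZ : #|'Z_N| = N by rewrite card_ord Zp_cast.
have cardA v : #|A v| = l.
  by rewrite card_imset ?card_ord // => i j /g_inj[].
exists A; split=> //.
- move=> u v neq_uv; apply/pred0P => x /=; apply/negbTE/negP.
  move=> /andP[/imsetP[i _ ->] /imsetP[j _ /g_inj[equv _]]].
  by rewrite equv eqxx in neq_uv.
- rewrite /= cats0; apply: perm_of_surj; first exact: enum_uniq.
    move=> x; rewrite mem_enum !inE => x_neq0.
    pose t := val x.
    have t_gt0 : 0 < t.
      by rewrite lt0n; apply: contraNneq x_neq0 => t0; apply/eqP/val_inj.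
    have t_lt : t < N by rewrite -[X in _ < X]cardZ card_ord ltn_ord.
    have xE : x = (t%:R)%R by rewrite natr_Zp.
    (* The residue t is the element at position r + 1 of the interval numbered d + 1. *)
    have := divn_eq t.-1 (l ^ 2); have := ltn_pmod t.-1 l2_gt0.
    set d := _ %/ _; set r := _ %% _ => ltr eqt.
    have ltdq : d < q by rewrite /N in t_lt; nia.
    have [//|u [v [Huv [[fuv fvu]|[fvu fuv]]]]] := surj d.+1.
      have [|i [j [lti ltj eqij]]] := @block_elt_difference l c (f u) (f v) r.+1 _ fuv.
        by lia.
      suff -> : x = (g v j - g u i)%R by apply: mem_arc_differences Huv _ _; apply: gA.
      rewrite /g eqij natrD addrK xE fvu /=; congr (_%:R)%R; lia.
    (* Here the arc goes from high to low, so N - t is sought as a high-minus-low difference: it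
       sits at position l^2 - r of the interval numbered q - d. *)
    have [|i [j [lti ltj eqij]]] := @block_elt_difference l c (f v) (f u) (l ^ 2 - r) _ fvu.
      by lia.
    suff -> : x = (g v i - g u j)%R by apply: mem_arc_differences Huv _ _; apply: gA.
    rewrite /g eqij natrD opprD addrCA subrr addr0 xE fuv.
    apply/eqP; rewrite eq_sym -subr_eq0 -opprD oppr_eq0 -natrD.
    have -> : l ^ 2 * (q.+1 - d.+1).-1 + (l ^ 2 - r) + t = N.
      rewrite /N; have -> : q = (q.+1 - d.+1).-1 + d.+1 by lia.
      by rewrite mulnDl mulSn; lia.
    by rewrite pchar_Zp.
  rewrite (size_arc_differences _ cardA) -[X in _ <= X]cardE cardsC1 cardZ /N addn1 /=.
  by rewrite leq_mul2r size_arcs orbT.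
Qed.

(** Each path zigzags between a rising low sequence and a falling high one, as in a graceful
    labelling of a path. The two zigzags have opposite phases, so rungs also join low to high. *)
Definition ladder_label (k : nat) (x : 'I_(2 * k + 1) + 'I_(2 * k + 1)) : nat :=
  match x with
  | inl i => if odd i then 6 * k + 1 - i./2 else i./2
  | inr i => if odd i then 2 * k + 1 + i./2 else 4 * k + 1 - i./2
  end.

(** The labels of even u, odd u, even v and odd v lie in the disjoint intervals [0, k],
    [5k+2, 6k+1], [3k+1, 4k+1] and [2k+1, 3k]. *)
Lemma ladder_label_inj (k : nat) : injective (@ladder_label k).
Proof.
by case=> [[i lti]|[i lti]] [[j ltj]|[j ltj]] /=; case: ifP => ?; case: ifP => ? ?;
  solve [congr inl; apply: val_inj => /=; lia
        |congr inr; apply: val_inj => /=; lia|exfalso; lia].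
Qed.

Lemma ladder_label_le (k : nat) (x : 'I_(2 * k + 1) + 'I_(2 * k + 1)) :
  ladder_label x <= 6 * k + 1.
Proof. by case: x => [[i lti]|[i lti]] /=; case: ifP; lia. Qed.

Lemma size_arcs_ladder (k : nat) : size (arcs (@ladder (2 * k + 1))) <= 6 * k + 1.
Proof.
set n := 2 * k + 1.
pose I i : 'I_n := insubd (Ordinal (ltn_addl (2 * k) (ltn0Sn 0))) i.
have I_val (i : 'I_n) : I i = i by rewrite /I valKd.
have I_eq (i : 'I_n) j : i = j :> nat -> i = I j by move=> <-.
pose s : seq (('I_n + 'I_n) * ('I_n + 'I_n)) :=
  [seq (inl (I i), inl (I i.+1)) | i <- iota 0 (2 * k)] ++
  [seq (inr (I i), inr (I i.+1)) | i <- iota 0 (2 * k)] ++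
  [seq (inr (I i), inl (I i)) | i <- iota 0 n].
have -> : 6 * k + 1 = size s by rewrite !size_cat !size_map !size_iota /n; lia.
apply: uniq_leq_size; first exact: enum_uniq.
case=> x y; rewrite mem_enum inE /= !mem_cat.
case: x y => [i|i] [j|j] //= Hij; apply/or3P.
- apply: Or31; apply/mapP; exists (i : nat); last by rewrite I_val -(I_eq _ _ (eqP Hij)).
  by rewrite mem_iota; move: (ltn_ord j); rewrite (eqP Hij) /n; lia.
- apply: Or33; apply/mapP; exists (i : nat); first by rewrite mem_iota /= ltn_ord.
  by rewrite I_val -(eqP Hij).
- apply: Or32; apply/mapP; exists (i : nat); last by rewrite I_val -(I_eq _ _ (eqP Hij)).
  by rewrite mem_iota; move: (ltn_ord j); rewrite (eqP Hij) /n; lia.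
Qed.

(* The u path covers the odd e above 4k+1 and the even e up to 2k, the v path the
   even e from 4k+2 and the odd e below 2k, and the rungs everything in between. *)
Lemma ladder_label_surj (k e : nat) : 0 < e <= 6 * k + 1 ->
  exists x y, realizes (@ladder (2 * k + 1)) (@ladder_label k) (3 * k) (6 * k + 1) e x y.
Proof.
pose n := 2 * k + 1.
pose R e := exists x y, realizes (@ladder n) (@ladder_label k) (3 * k) (6 * k + 1) e x y.
(* At index i the labels differ by 6k+1-i along the u path, 2k-i along the v path and 4k+1-i on the
   rung. An arc from high to low has e equal to 6k+2 minus this value. *)
have uu i : i < 2 * k -> R (if odd i then i.+1 else 6 * k + 1 - i).
  move=> lti; have lt1 : i < n by lia.
  have lt2 : i.+1 < n by lia.
  exists (inl (Ordinal lt1)), (inl (Ordinal lt2)); rewrite /realizes /= eqxx.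
  by split=> //; case: (boolP (odd i)) => /= ?; lia.
have vv i : i < 2 * k -> R (if odd i then 2 * k - i else 4 * k + 2 + i).
  move=> lti; have lt1 : i < n by lia.
  have lt2 : i.+1 < n by lia.
  exists (inr (Ordinal lt1)), (inr (Ordinal lt2)); rewrite /realizes /= eqxx.
  by split=> //; case: (boolP (odd i)) => /= ?; lia.
have vu i : i < n -> R (if odd i then 4 * k + 1 - i else 2 * k + 1 + i).
  move=> lti; exists (inr (Ordinal lti)), (inl (Ordinal lti)); rewrite /realizes /= eqxx.
  by split=> //; case: (boolP (odd i)) => /= ?; lia.
move=> /andP[e_gt0 le_e].
have [odd_e|even_e] := boolP (odd e).
- have [lt1|le1] := ltnP e (2 * k).
    have := vv (2 * k - e); rewrite ifT; last by lia.
    by rewrite subKn; [apply; lia | lia].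
  have [lt2|le2] := ltnP (4 * k + 1) e.
    have := uu (6 * k + 1 - e); rewrite ifF; last by lia.
    by rewrite subKn //; apply; lia.
  have := vu (e - (2 * k + 1)); rewrite ifF; last by lia.
  by rewrite subnKC; [apply; lia | lia].
- have [le1|lt1] := leqP e (2 * k).
    have := uu e.-1; rewrite ifT; last by lia.
    by rewrite prednK //; apply; lia.
  have [le2|lt2] := leqP e (4 * k).
    have := vu (4 * k + 1 - e); rewrite ifT; last by lia.
    by rewrite subKn; [apply; lia | lia].
  have := vv (e - (4 * k + 2)); rewrite ifF; last by lia.
  by rewrite subnKC; [apply; lia | lia].
Qed.

Theorem theorem6p9 (k l : nat) (hk : 1 <= k) (hl : 1 <= l) :
  exists A : ('I_(2 * k + 1) + 'I_(2 * k + 1))%type ->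
             {set 'Z_((6 * k + 1) * l ^ 2 + 1)},
    is_EDF ((6 * k + 1) * l ^ 2 + 1) (4 * k + 2) l 1 (@ladder (2 * k + 1)) A.
Proof.
have -> : 4 * k + 2 = #|{: 'I_(2 * k + 1) + 'I_(2 * k + 1)}|.
  by rewrite card_sum !card_ord; lia.
apply: (@EDF_of_labelling _ _ (@ladder_label k) _ (3 * k)) => //.
- by lia.
- exact: ladder_label_inj.
- exact: ladder_label_le.
- exact: size_arcs_ladder.
- exact: ladder_label_surj.
Qed.
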